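(* Let $n\geq 2$ be an even integer, let $R_n$ be the dihedral quandle of order $n$, and identify $\operatorname{Aut}R_n$ with $\mathbb{Z}/n\mathbb{Z}\rtimes(\mathbb{Z}/n\mathbb{Z})^\times$, where $(a,u)$ corresponds to the affine map $k\mapsto a+uk$ of $\mathbb{Z}/n\mathbb{Z}$. Let $U_{R_n}$ be the set of GL-structures on $R_n$, and write $\mathtt{u}_1\sim\mathtt{u}_2$ if and only if $(R_n,\mathtt{u}_1)\cong(R_n,\mathtt{u}_2)$ as GL-racks. Then $$U_{R_n}=\begin{cases}\{0,n/2\}\rtimes\{1\}&\text{if }4\nmid n,\\ \{0,n/2\}\rtimes\{1,1+n/2\}&\text{if }4\mid n.\end{cases}$$ If $4\nmid n$, then $U_{R_n}=U_{R_n}/{\sim}$ (every $\sim$-class is a singleton), so $|U_{R_n}/{\sim}|=2$. Otherwise, the only (distinct) elements of $U_{R_n}$ that are identified in $U_{R_n}/{\sim}$ are $(0,1+n/2)$ and $(n/2,1+n/2)$, so $|U_{R_n}/{\sim}|=3$.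
   Context: For a set $X$, $S_X$ is the group of permutations of $X$; products of maps denote composition. A rack is a pair $(X,s)$ of a set $X$ and a map $s:X\to S_X$, $x\mapsto s_x$, such that $s_xs_y=s_{s_x(y)}s_x$ for all $x,y\in X$. A rack homomorphism $(X,s)\to(Y,t)$ is a map $\varphi:X\to Y$ with $\varphi s_x=t_{\varphi(x)}\varphi$ for all $x\in X$, and $\operatorname{Aut}R$ is the group of rack automorphisms of $R$. The dihedral quandle $R_n$ is the rack with underlying set $\mathbb{Z}/n\mathbb{Z}$ and $s_b(a):=2b-a$. It is a known fact that $\operatorname{Aut}R_n$ is the group of all affine transformations $k\mapsto a+uk$ with $a\in\mathbb{Z}/n\mathbb{Z}$, $u\in(\mathbb{Z}/n\mathbb{Z})^\times$. A GL-structure on $R=(X,s)$ is an automorphism $\mathtt{u}\in\operatorname{Aut}R$ such that $\mathtt{u}s_x=s_x\mathtt{u}$ for all $x\in X$; the pair $(R,\mathtt{u})$ is called a GL-rack. A GL-rack homomorphism $(R_1,\mathtt{u}_1)\to(R_2,\mathtt{u}_2)$ is a rack homomorphism $\varphi$ with $\varphi\mathtt{u}_1=\mathtt{u}_2\varphi$; isomorphisms are bijective homomorphisms. *)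

(* Defs.v *)
From HB Require Import structures.
From mathcomp Require Import all_boot all_order all_algebra all_fingroup.
From mathcomp Require Import boolp ring.

Set Implicit Arguments.
Unset Strict Implicit.
Unset Printing Implicit Defensive.

Import GRing.Theory.
Local Open Scope ring_scope.

(* The map s : X -> S_X is rendered as a family of bijective functions, so    *)
(* that products of permutations are literally compositions of functions      *)
(* (the group law of {perm _} is composition in the opposite order).          *)
Record rack := Rack {
  rack_sort :> Type;
  rack_s : rack_sort -> rack_sort -> rack_sort;
  rack_s_bij : forall x, bijective (rack_s x);
  rack_sE : forall x y, rack_s x \o rack_s y =1 rack_s (rack_s x y) \o rack_s x
}.

Definition rack_hom (R Q : rack) (phi : R -> Q) : Prop :=
  forall x, phi \o rack_s x =1 rack_s (phi x) \o phi.

Definition rack_aut (R : rack) (phi : R -> R) : Prop :=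
  bijective phi /\ rack_hom phi.

Definition gl_structure (R : rack) (u : R -> R) : Prop :=
  rack_aut u /\ forall x, u \o rack_s x =1 rack_s x \o u.

Record gl_rack := GLRack {
  gl_rack_sort :> rack;
  gl_map : gl_rack_sort -> gl_rack_sort;
  gl_mapP : gl_structure gl_map
}.

Definition gl_hom (L M : gl_rack) (phi : L -> M) : Prop :=
  rack_hom phi /\ phi \o @gl_map L =1 @gl_map M \o phi.

Definition gl_isomorphic (L M : gl_rack) : Prop :=
  exists phi : L -> M, bijective phi /\ gl_hom phi.

Section DihedralQuandle.

Variable n : nat.

(* For n >= 2, 'Z_n is Z/nZ ('Z_0 and 'Z_1 are both Z/2Z).                    *)
Definition dihedral_s (b a : 'Z_n) : 'Z_n := b *+ 2 - a.

Fact dihedral_s_bij b : bijective (dihedral_s b).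
Proof. by exists (dihedral_s b) => a; rewrite /dihedral_s subKr. Qed.

Fact dihedral_sE x y :
  dihedral_s x \o dihedral_s y =1 dihedral_s (dihedral_s x y) \o dihedral_s x.
Proof. by move=> z; rewrite /= /dihedral_s; ring. Qed.

Definition dihedral : rack := Rack dihedral_s_bij dihedral_sE.

Definition dihedral_gl : {set {perm 'Z_n}} :=
  [set u : {perm 'Z_n} | `[< @gl_structure dihedral u >]].

Definition dihedral_gl_equiv (u1 u2 : {perm 'Z_n}) : bool :=
  `[< exists (h1 : @gl_structure dihedral u1) (h2 : @gl_structure dihedral u2),
        gl_isomorphic (GLRack h1) (GLRack h2) >].

Definition dihedral_gl_classes : {set {set {perm 'Z_n}}} :=
  equivalence_partition dihedral_gl_equiv dihedral_gl.

Fact affine_subproof (p : 'Z_n * {unit 'Z_n}) :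
  injective (fun k : 'Z_n => p.1 + val p.2 * k).
Proof. by move=> k l /addrI; apply: mulrI; exact: valP p.2. Qed.

(* The pairs (a, u) are the elements of Z/nZ ><| (Z/nZ)^*; [affine] is the    *)
(* identification of this group with Aut R_n, by the three facts that follow. *)
Definition affine (p : 'Z_n * {unit 'Z_n}) : {perm 'Z_n} :=
  perm (@affine_subproof p).

Fact affineM (a b : 'Z_n) (u v : {unit 'Z_n}) :
  affine (a + val u * b, (u * v)%g) =1 affine (a, u) \o affine (b, v).
Proof. by move=> k; rewrite /= !permE /= mulrDr addrA mulrA. Qed.

Fact affine_inj : injective affine.
Proof.
move=> [a u] [b v] /permP e.
have eab : a = b by have := e 0; rewrite !permE /= !mulr0 !addr0.
have := e 1; rewrite !permE /= !mulr1 eab => /addrI euv.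
by congr (_, _); apply: val_inj.
Qed.

Fact affine_autP (f : {perm 'Z_n}) :
  @rack_aut dihedral f <-> exists p, f = affine p.
Proof.
split=> [[_ f_hom]|[p ->]]; last first.
  split; first exact: injF_bij (@perm_inj _ _).
  by move=> x k; rewrite /= !permE /dihedral_s; ring.
pose d := f 1 - f 0.
have fS (k : nat) : f k%:R = f 0 + d * k%:R /\ f k.+1%:R = f 0 + d * k.+1%:R.
  elim: k => [|k [IH IH1]]; first by rewrite mulr0 mulr1 addr0 /d addrC subrK.
  split=> //; have := f_hom k.+1%:R k%:R; rewrite /= /dihedral_s IH IH1.
  have -> : k.+1%:R *+ 2 - k%:R = k.+2%:R :> 'Z_n by ring.
  by move=> ->; ring.
have fE k : f k = f 0 + d * k by rewrite -[k]natr_Zp; case: (fS k).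
have d_unit : d \is a GRing.unit.
  have [g _ gK] := injF_bij (@perm_inj _ f).
  apply/unitrPr; exists (g (f 0 + 1)).
  by apply: (@addrI _ (f 0)); rewrite -fE gK.
by exists (f 0, FinRing.unit 'Z_n d_unit); apply/permP => k; rewrite permE /= fE.
Qed.

End DihedralQuandle.

(* Main.v *)
Require Import Defs.
From mathcomp Require Import all_boot all_order all_algebra all_fingroup.
From mathcomp Require Import boolp ring.

Import GRing.Theory.
Local Open Scope ring_scope.

(** The affine map [(a, u)] commutes with every [k |-> 2x - k] if and only if
    [2a = 0] and [2u = 2], that is [a] and [u - 1] lie in [{0, n/2}]; and
    [1 + n/2] is a unit exactly when [4 | n].  Conjugation by [(c, v)] maps
    [(a, u)] to [(v a + (1 - u) c, u)].  Since [v] is odd, [v a = a] for [a] in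
    [{0, n/2}], so nothing is identified when [u = 1], while for [u = 1 + n/2]
    the term [(1 - u) c] takes both values [0] and [n/2]. *)

Lemma natr_Zn_eq0 (n k : nat) : (1 < n)%N -> (k%:R == 0 :> 'Z_n) = (n %| k)%N.
Proof. by move=> n_gt1; rewrite -val_eqE /= val_Zp_nat. Qed.

Lemma affineE (n : nat) (a : 'Z_n) (u : {unit 'Z_n}) (k : 'Z_n) :
  affine (a, u) k = a + val u * k.
Proof. by rewrite permE. Qed.

Section DihedralGL.

Variable n : nat.
Hypotheses (n_ge2 : (2 <= n)%N) (n_even : ~~ odd n).

Let h : 'Z_n := (n %/ 2)%:R.

Let nE : n = (n %/ 2 * 2)%N.
Proof. by rewrite divnK // dvdn2. Qed.

Let half_gt0 : (0 < n %/ 2)%N.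
Proof. by rewrite divn_gt0. Qed.

Lemma half_neq0 : h != 0.
Proof. by rewrite /h natr_Zn_eq0 // gtnNdvd // ltn_Pdiv // ltnW. Qed.

(** For the representative of [a] below [n], divisibility of [2 a] by [n] means divisibility of [a]
    by [n / 2], which leaves only the quotients 0 and 1. *)
Lemma mul2_eq0_half (a : 'Z_n) : (a *+ 2 == 0) = (a \in [set 0; h]).
Proof.
apply/idP/set2P => [|[]->]; last 2 first.
- by rewrite mul0rn.
- by rewrite /h -mulrnA -nE natr_Zn_eq0.
rewrite -[a]natr_Zp -mulrnA natr_Zn_eq0 // {1}nE dvdn_pmul2r //.
case/dvdnP => q aE; have : (a < n)%N.
  by have := ltn_ord a; rewrite [X in (_ < X)%N]Zp_cast.
rewrite aE [X in (_ < X)%N]nE mulnC ltn_pmul2l //.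
by case: q {aE} => [|[|q]] // _; [left; rewrite muln0 | right; rewrite muln1].
Qed.

Lemma half_add_half : h + h = 0.
Proof. by apply/eqP; rewrite -mulr2n mul2_eq0_half set22. Qed.

(** Since [h + h = 0], the product [h * k] depends only on the parity of [k]; here [k = n / 2],
    which is even exactly when 4 divides [n]. *)
Lemma half_mul_half : h * h = if (4 %| n)%N then 0 else h.
Proof.
have -> : (4 %| n)%N = (2 %| n %/ 2)%N by rewrite [in LHS]nE (@dvdn_pmul2r 2 2).
have hE k : h * k%:R = h *+ odd k.
  rewrite mulr_natr -[k in LHS]odd_double_half mulrnDr -mul2n mulrnA mulr2n.
  by rewrite half_add_half mul0rn addr0.
by rewrite {2}/h hE dvdn2; case: odd.
Qed.

(** Doubling kills [v * h], so it is [0] or [h], and a unit cannot send [h] to [0]. *)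
Lemma unit_mul_half (v : {unit 'Z_n}) : val v * h = h.
Proof.
have : val v * h \in [set 0; h].
  by rewrite -mul2_eq0_half mulr2n -mulrDr half_add_half mulr0.
case/set2P => // /eqP; rewrite mulrI_eq0; last exact: mulrI (valP v).
by rewrite (negPf half_neq0).
Qed.

(** The two sides of the commutation with [s_x], evaluated at [k], differ by [2 a + 2 (u - 1) x], so
    [x = 0] and [x = 1] already give both conditions. *)
Lemma gl_affineP (a : 'Z_n) (u : {unit 'Z_n}) :
  (affine (a, u) \in dihedral_gl n) =
  (a \in [set 0; h]) && (val u - 1 \in [set 0; h]).
Proof.
rewrite inE -!mul2_eq0_half; apply/asboolP/andP.
  case=> _ u_s.
  have comm x k : a + val u * (x *+ 2 - k) = x *+ 2 - (a + val u * k).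
    by rewrite -!affineE; apply: u_s.
  have a2 : a *+ 2 = 0.
    transitivity (a + val u * (0 *+ 2 - 0) - (0 *+ 2 - (a + val u * 0))).
      by ring.
    by rewrite comm subrr.
  split; first by rewrite a2.
  apply/eqP; transitivity
    (a + val u * (1 *+ 2 - 0) - (1 *+ 2 - (a + val u * 0)) - a *+ 2).
    by ring.
  by rewrite comm a2 !subrr.
case=> /eqP a2 /eqP u2; split; first by apply/affine_autP; exists (a, u).
move=> x k; rewrite /comp !affineE /= /dihedral_s; apply/subr0_eq.
transitivity (a *+ 2 + (val u - 1) *+ 2 * x); first by rewrite /=; ring.
by rewrite a2 u2 mul0r addr0.
Qed.

Lemma gl_affine (f : {perm 'Z_n}) : f \in dihedral_gl n -> exists p, f = affine p.
Proof. by rewrite inE => /asboolP[/affine_autP]. Qed.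

(** The multiplier [w] of an isomorphism leaves no trace because [w a = a], so translations by [c]
    realise every equivalence. *)
Lemma gl_equiv_affineP (a b : 'Z_n) (u v : {unit 'Z_n}) :
  affine (a, u) \in dihedral_gl n -> affine (b, v) \in dihedral_gl n ->
  dihedral_gl_equiv (affine (a, u)) (affine (b, v)) <->
  u = v /\ exists c, b = a + (1 - val u) * c.
Proof.
move=> gl_au gl_bv.
have a_half (w : {unit 'Z_n}) : val w * a = a.
  move: gl_au; rewrite gl_affineP => /andP[/set2P[]-> _].
    by rewrite mulr0.
  exact: unit_mul_half.
split=> [/asboolP[gl1 [gl2 [phi [phi_bij [phi_hom phi_gl]]]]]|[uv [c bE]]].
  have [[c w] phiE] : exists p, perm (bij_inj phi_bij) = affine p.
    apply/affine_autP; split; first exact: injF_bij (@perm_inj _ _).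
    by move=> x k; rewrite /= !permE; apply: phi_hom.
  have {}phiE k : phi k = c + val w * k.
    by rewrite -[LHS](permE (bij_inj phi_bij)) phiE permE.
  have comm k : c + val w * (a + val u * k) = b + val v * (c + val w * k).
    by have := phi_gl k; rewrite /= !phiE !permE.
  have e0 := comm 0; have e1 := comm 1.
  have uv : u = v.
    (* Subtracting the values of [comm] at 0 and 1 gives [w u = v w], and [w] cancels. *)
    apply/val_inj/(mulrI (valP w)); transitivity
      (c + val w * (a + val u * 1) - (c + val w * (a + val u * 0))).
      by ring.
    by rewrite e0 e1; ring.
  split=> //; exists c; rewrite -uv in e0; rewrite -[in RHS](a_half w).
  transitivity (b + val u * (c + val w * 0) - val u * c); first by ring.
  by rewrite -e0; ring.
subst v; apply/asboolP; move: gl_au gl_bv; rewrite !inE => /asboolP gl1 /asboolP gl2.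
exists gl1, gl2, (affine (c, 1%g)); split; first exact: injF_bij (@perm_inj _ _).
split; first by have /affine_autP[] : exists p, affine (c, 1%g) = @affine n p
  by exists (c, 1%g).
move=> k; change (affine (c, 1%g) (affine (a, u) k) =
                  affine (b, u) (affine (c, 1%g) k)).
by rewrite !affineE FinRing.val_unit1 bE !mul1r; ring.
Qed.

Lemma gl_equiv_refl : {in dihedral_gl n, reflexive (@dihedral_gl_equiv n)}.
Proof.
move=> f gl_f; have [[a u] fE] := gl_affine _ gl_f.
move: gl_f; rewrite fE => gl_au; apply/gl_equiv_affineP => //.
by split=> //; exists 0; rewrite mulr0 addr0.
Qed.

(** This is the block that [equivalence_partition] attaches to [f]; naming it turns the count of
    classes into the cardinality of an image. *)
Definition gl_class (f : {perm 'Z_n}) : {set {perm 'Z_n}} :=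
  [set g in dihedral_gl n | dihedral_gl_equiv f g].

Lemma dihedral_gl_classesE :
  dihedral_gl_classes n = gl_class @: dihedral_gl n.
Proof. by apply: eq_imset => f; apply/setP => g; rewrite !inE. Qed.

Lemma in_gl_class f g :
  (g \in gl_class f) = (g \in dihedral_gl n) && dihedral_gl_equiv f g.
Proof. by rewrite in_set. Qed.

(** By reflexivity [g] lies in its own class, hence in that of [f]. *)
Lemma gl_class_eq_equiv :
  {in dihedral_gl n &, forall f g,
    gl_class f = gl_class g -> dihedral_gl_equiv f g}.
Proof.
move=> f g _ gl_g /setP/(_ g).
by rewrite !in_gl_class gl_g gl_equiv_refl //= => ->.
Qed.

(** Common to both cases, which differ in whether [1 + h] is a unit. *)
Lemma dihedral_gl_imset (U : {set {unit 'Z_n}}) :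
  (forall u : {unit 'Z_n}, (u \in U) = (val u - 1 \in [set 0; h])) ->
  dihedral_gl n = @affine n @: setX [set 0; h] U.
Proof.
move=> inU; apply/setP => f; apply/idP/imsetP => [gl_f|[[a u]]].
  have [[a u] fE] := gl_affine _ gl_f; exists (a, u) => //.
  by rewrite in_setX inU -gl_affineP -fE.
by rewrite in_setX inU -gl_affineP => ? ->.
Qed.

Lemma half_set_unitE (u : {unit 'Z_n}) :
  (val u - 1 \in [set 0; h]) = (val u == 1) || (val u == 1 + h).
Proof. by rewrite in_set2 subr_eq0 subr_eq [h + 1]addrC. Qed.

Lemma card_half_setX (U : {set {unit 'Z_n}}) :
  #|@affine n @: setX [set 0; h] U| = (2 * #|U|)%N.
Proof.
by rewrite card_imset; [rewrite cardsX cards2 eq_sym half_neq0 | apply: affine_inj].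
Qed.

Lemma dihedral_gl_not4 : ~~ (4 %| n)%N ->
  [/\ dihedral_gl n = @affine n @: setX [set 0; h] [set 1%g],
      {in dihedral_gl n &, forall u1 u2,
        dihedral_gl_equiv u1 u2 -> u1 = u2}
    & #|dihedral_gl_classes n| = 2%N].
Proof.
move=> n4; have glE : dihedral_gl n = @affine n @: setX [set 0; h] [set 1%g].
  apply: dihedral_gl_imset => u; rewrite half_set_unitE in_set1 -val_eqE.
  (* If [u = 1 + h] were a unit, then [h = u h = h + h * h = h + h = 0]. *)
  case: (val u =P 1 + h) => [uE|_]; last by rewrite orbF.
  have := unit_mul_half u; rewrite uE mulrDl mul1r half_mul_half (negPf n4).
  by rewrite half_add_half => /esym/eqP; rewrite (negPf half_neq0).
have eq_of_equiv : {in dihedral_gl n &, forall u1 u2,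
    dihedral_gl_equiv u1 u2 -> u1 = u2}.
  move=> f g gl_f gl_g; move: (gl_f) (gl_g); rewrite {1 2}glE.
  case/imsetP=> -[a u]; rewrite in_setX in_set1 => /andP[_ /eqP/= u1] fE.
  case/imsetP=> -[b v] _ gE.
  rewrite {}fE {}gE {}u1 in gl_f gl_g *.
  by case/gl_equiv_affineP=> // <- [c ->]; rewrite subrr mul0r addr0.
split=> //; rewrite dihedral_gl_classesE.
rewrite card_in_imset; first by rewrite glE card_half_setX cards1.
by move=> f g gl_f gl_g /gl_class_eq_equiv/eq_of_equiv-> //.
Qed.

Lemma dihedral_gl_4 : (4 %| n)%N ->
  exists2 w : {unit 'Z_n}, val w = 1 + h &
  [/\ dihedral_gl n = @affine n @: setX [set 0; h] [set 1%g; w],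
      affine (0, w) != affine (h, w),
      {in dihedral_gl n &, forall u1 u2, u1 != u2 ->
        (dihedral_gl_equiv u1 u2 <->
         [set u1; u2] = [set affine (0, w); affine (h, w)])}
    & #|dihedral_gl_classes n| = 3%N].
Proof.
move=> n4.
have w_unit : 1 + h \is a GRing.unit.
  (* As [h * h = 0] when 4 divides [n], [1 + h] is its own inverse. *)
  apply/unitrPr; exists (1 + h).
  by rewrite mulrDl mul1r mulrDr mulr1 half_mul_half n4 addr0 -addrA
    half_add_half addr0.
pose w := FinRing.unit 'Z_n w_unit; have wE : val w = 1 + h by [].
have w1 : 1 - val w = h.
  by rewrite wE opprD addrA subrr add0r; apply/esym/eqP; rewrite -addr_eq0
    half_add_half.
clearbody w; exists w => //.
have w_neq1 : 1%g != w.
  by rewrite -val_eqE /= -subr_eq0 w1 half_neq0.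
have glE : dihedral_gl n = @affine n @: setX [set 0; h] [set 1%g; w].
  by apply: dihedral_gl_imset => u; rewrite half_set_unitE in_set2 -!val_eqE wE.
have e01 : affine (0, w) != affine (h, w).
  by rewrite (inj_eq (@affine_inj n)) xpair_eqE eqxx andbT eq_sym half_neq0.
have gl_e a : a \in [set 0; h] -> affine (a, w) \in dihedral_gl n.
  by move=> ah; rewrite glE imset_f // in_setX ah set22.
have gl_e0 := gl_e _ (set21 _ _); have gl_e1 := gl_e _ (set22 _ _).
have equivP : {in dihedral_gl n &, forall u1 u2, u1 != u2 ->
    (dihedral_gl_equiv u1 u2 <->
     [set u1; u2] = [set affine (0, w); affine (h, w)])}.
  move=> f g gl_f gl_g f_neq_g; split=> [fg|fgE].
    move: (gl_f) (gl_g); rewrite {1 2}glE.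
    case/imsetP=> -[a u] /setXP[/= ah uw] fE.
    case/imsetP=> -[b v] /setXP[/= bh _] gE.
    rewrite {}fE {}gE in gl_f gl_g f_neq_g fg *.
    case/gl_equiv_affineP: fg f_neq_g => // uv [c bE]; subst v.
    case/set2P: uw => uE; subst u.
      by rewrite bE FinRing.val_unit1 subrr mul0r addr0 eqxx.
    by case/set2P: ah => ->; case/set2P: bh => ->; rewrite ?eqxx // setUC.
  have := set21 f g; have := set22 f g; rewrite fgE.
  (* The witness [c = 1] shifts the translation part by [1 - w = h], which exchanges [0] and [h]. *)
  case/set2P=> gE /set2P[] fE; rewrite fE gE ?eqxx // in f_neq_g *;
    apply/gl_equiv_affineP => //; split=> //; exists 1; rewrite mulr1 w1.
  - by rewrite half_add_half.
  - by rewrite add0r.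
split=> //; rewrite dihedral_gl_classesE.
(* Dropping [affine (h, w)], whose class is that of [affine (0, w)], leaves one representative per
   class. *)
have -> : gl_class @: dihedral_gl n =
    gl_class @: (dihedral_gl n :\ affine (h, w)).
  rewrite -{1}(setD1K gl_e1) imsetU1; apply/setUidPr; rewrite sub1set.
  apply/imsetP; exists (affine (0, w)); first by rewrite in_setD1 e01.
  apply/setP => g; rewrite !in_gl_class; apply/andb_id2l => gl_g.
  have [[b v] gE] := gl_affine _ gl_g; rewrite {}gE in gl_g *.
  (* Replacing [c] by [c + 1] adds [h] to [h * c], which absorbs the difference between the two
     translation parts. *)
  by apply/idP/idP => /gl_equiv_affineP[] // vw [c bE]; subst v b;
    apply/gl_equiv_affineP => //; split=> //; exists (c + 1);
    rewrite w1 mulrDr mulr1 [h * c + h]addrC addrA ?half_add_half ?add0r.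
rewrite card_in_imset.
  (* Of the [2 * 2] structures, one has been removed. *)
  have := cardsD1 (affine (h, w)) (dihedral_gl n).
  by rewrite gl_e1 {1}glE card_half_setX cards2 w_neq1 => -[].
move=> f g; rewrite !in_setD1 => /andP[f1 gl_f] /andP[g1 gl_g].
move=> /gl_class_eq_equiv fg; apply/eqP; apply: contraT => f_neq_g.
(* Distinct structures with equal classes would form the identified pair, which contains the removed
   [affine (h, w)]. *)
have /setP/(_ (affine (h, w))) := (equivP f g gl_f gl_g f_neq_g).1 (fg gl_f gl_g).
by rewrite !in_set2 eqxx orbT ![affine _ == _]eq_sym (negPf f1) (negPf g1).
Qed.

End DihedralGL.

Theorem proposition4p11 (n : nat) (n_ge2 : (2 <= n)%N) (n_even : ~~ odd n) :
  let h : 'Z_n := (n %/ 2)%:R in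
  (~~ (4 %| n)%N ->
    [/\ dihedral_gl n = @affine n @: setX [set 0; h] [set 1%g],
        {in dihedral_gl n &, forall u1 u2,
          dihedral_gl_equiv u1 u2 -> u1 = u2}
      & #|dihedral_gl_classes n| = 2%N])
  /\
  ((4 %| n)%N ->
    exists2 w : {unit 'Z_n}, val w = 1 + h &
    [/\ dihedral_gl n = @affine n @: setX [set 0; h] [set 1%g; w],
        affine (0, w) != affine (h, w),
        {in dihedral_gl n &, forall u1 u2, u1 != u2 ->
          (dihedral_gl_equiv u1 u2 <->
           [set u1; u2] = [set affine (0, w); affine (h, w)])}
      & #|dihedral_gl_classes n| = 3%N]).
Proof.
by split; [exact: dihedral_gl_not4 | exact: dihedral_gl_4].
Qed.
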